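(* Let $k\ge 1$ be an integer and let $a,c$ be real numbers with $a\neq 0,1$, $c\neq k+1,k,k-1,\dots$ (i.e. $c$ is not an integer $\le k+1$), and $m_k^{1/a,-c+2}(-n)\neq 0$ for all $n\ge 1$, where $m_k^{1/a,-c+2}$ is a Meixner polynomial. Define $$\lambda_n=\frac{1}{a-1}m_{k+1}^{1/a,-c+1}(-n)\ (n\ge 0),\qquad \gamma_n=m_k^{1/a,-c+2}(-n),\qquad \beta_n=-\frac{\gamma_{n+1}}{\gamma_n}\ (n\ge 1),$$ and the polynomials $q_0=1$, $q_n(x)=m_n^{a,c}(x)+\beta_nm_{n-1}^{a,c}(x)$ for $n\ge 1$. Then the polynomials $(q_n)_n$ are orthogonal with respect to the moment functional $$\tilde\rho_{k,a,c}=(x+c-1)\cdots(x+c-k)\,\rho_{a,c-k-1},$$ where $\rho_{a,c-k-1}$ is the Meixner moment functional with parameters $a$ and $c-k-1$. Moreover, let $$D=P_1(D_{a,c})+\frac{a}{1-a}\Delta P_2(D_{a,c}),$$ $$P_1(x)=\frac{1}{a-1}m_{k+1}^{1/a,-c+1}\Big(-\frac{x}{a-1}\Big),\qquad P_2(x)=m_k^{1/a,-c+2}\Big(-\frac{x}{a-1}-1\Big),$$ where $D_{a,c}$ is the second order Meixner difference operator. Then $D$ is a difference operator of order $2k+2$ and genre $(-k-1,k+1)$, and $D(q_n)=\lambda_nq_n$ for all $n\ge 0$.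
   Context: For $l\in\mathbb{Z}$ the shift operator $\mathfrak{s}_l$ acts on polynomials by $\mathfrak{s}_l(f)(x)=f(x+l)$; $\Delta f(x)=f(x+1)-f(x)$. A finite difference operator $\sum_{l=s}^r f_l\,\mathfrak{s}_l$ (with polynomial coefficients $f_l$) with $f_s,f_r\neq 0$ has order $r-s$ and genre $(s,r)$. For a linear operator $T$ and a polynomial $P(x)=\sum_j a_jx^j$, $P(T)=\sum_j a_jT^j$; products of operators are compositions. Meixner polynomials (for $a\neq 0,1$ and any real $c$): $m_n^{a,c}(x)=(-1)^n\sum_{j=0}^na^{-j}\binom{x}{j}\binom{-x-c}{n-j}$. Meixner operator: $D_{a,c}=x\,\mathfrak{s}_{-1}-[(1+a)x+ac]\,\mathfrak{s}_0+a(x+c)\,\mathfrak{s}_1$, $D_{a,c}(m_n^{a,c})=n(a-1)m_n^{a,c}$. A moment functional is a linear map $\mu:\mathbb{P}\to\mathbb{R}$ on the space $\mathbb{P}$ of real polynomials; for a polynomial $r$, $\langle r\mu,p\rangle=\langle\mu,rp\rangle$. For $a\neq 0,1$ and $c\neq 0,-1,-2,\dots$, the Meixner moment functional $\rho_{a,c}$ is the unique moment functional with respect to which $(m_n^{a,c})_n$ are orthogonal, normalized by $\langle\rho_{a,c},1\rangle=\Gamma(c)$ (for $0<|a|<1$ it is given by the measure $(1-a)^c\sum_{x=0}^\infty\frac{a^x\Gamma(x+c)}{x!}\delta_x$). Polynomials $(q_n)_n$ with $\deg q_n=n$ are orthogonal with respect to $\mu$ if $\langle\mu,q_nx^m\rangle=0$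 for $0\le m<n$ and $\langle\mu,q_nx^n\rangle\neq 0$ for all $n$. *)

(* Defs.v *)
From HB Require Import structures.
From mathcomp Require Import all_boot all_order all_algebra.
From mathcomp Require Import all_classical all_reals all_analysis.
Set Implicit Arguments.
Unset Strict Implicit.
Unset Printing Implicit Defensive.
Import Order.TTheory GRing.Theory Num.Theory.
Import numFieldNormedType.Exports.
Local Open Scope ring_scope.

Definition shift_op (R : realType) (l : int) (f : {poly R}) : {poly R} :=
  f \Po ('X + (l%:~R)%:P).

Definition Delta (R : realType) (f : {poly R}) : {poly R} :=
  shift_op 1 f - f.

Definition op_poly (R : realType) (P : {poly R}) (T : {poly R} -> {poly R})
    (f : {poly R}) : {poly R} :=
  \sum_(j < size P) P`_j *: iter j T f.

(* The summation range is l = s, s + 1, ..., r. *)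
Definition has_genre (R : realType) (T : {poly R} -> {poly R}) (s r : int) :
    Prop :=
  s <= r /\
  exists f : int -> {poly R},
    [/\ f s != 0, f r != 0 &
        forall p, T p =
          \sum_(i < `|r - s|%N.+1) f (s + i%:Z) * shift_op (s + i%:Z) p].

Definition has_order (R : realType) (T : {poly R} -> {poly R}) (d : nat) :
    Prop :=
  exists s r : int, has_genre T s r /\ r - s = d%:Z.

Definition binom_poly (R : realType) (p : {poly R}) (j : nat) : {poly R} :=
  (j`!%:R)^-1 *: \prod_(i < j) (p - (i%:R)%:P).

Definition meixner (R : realType) (a c : R) (n : nat) : {poly R} :=
  (-1) ^+ n *: \sum_(j < n.+1)
    a ^- j *: (binom_poly 'X j * binom_poly (- 'X - c%:P) (n - j)).

Definition meixner_op (R : realType) (a c : R) (f : {poly R}) : {poly R} :=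
  'X * shift_op (-1) f
  - ((1 + a) *: 'X + (a * c)%:P) * shift_op 0 f
  + a *: ('X + c%:P) * shift_op 1 f.

Definition mul_functional (R : realType) (r : {poly R})
    (mu : {scalar {poly R}}) (p : {poly R}) : R := mu (r * p).

Lemma mul_functional_is_scalar (R : realType) (r : {poly R})
    (mu : {scalar {poly R}}) : scalar (mul_functional r mu).
Proof. by move=> x p q; rewrite /mul_functional mulrDr -scalerAr linearP. Qed.

HB.instance Definition _ (R : realType) (r : {poly R})
    (mu : {scalar {poly R}}) :=
  GRing.isLinear.Build R {poly R} R *%R (mul_functional r mu)
    (mul_functional_is_scalar r mu).

Definition orthogonal_polys (R : realType) (mu : {scalar {poly R}})
    (q : nat -> {poly R}) : Prop :=
  [/\ forall n, size (q n) = n.+1,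
      forall n m, (m < n)%N -> mu (q n * 'X^m) = 0 &
      forall n, mu (q n * 'X^n) != 0].

(* Gauss's product: for every real x other than 0, -1, -2, ... the sequence
   n! n^x / (x (x + 1) ... (x + n)) converges to Gamma(x); in particular this
   covers negative non-integers. *)
Definition Gamma (R : realType) (x : R) : R :=
  limn (fun n : nat =>
    n`!%:R * (n%:R `^ x) / \prod_(i < n.+1) (x + i%:R)).

(* For a <> 0, 1 and c <> 0, -1, -2, ... exactly one functional satisfies
   this. *)
Definition is_meixner_functional (R : realType) (a c : R)
    (rho : {scalar {poly R}}) : Prop :=
  orthogonal_polys rho (meixner a c) /\ rho 1 = Gamma c.

Definition rho_tilde (R : realType) (k : nat) (c : R)
    (rho : {scalar {poly R}}) : {scalar {poly R}} :=
  mul_functional (\prod_(1 <= i < k.+1) ('X + (c - i%:R)%:P)) rho.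

Definition lambda_ (R : realType) (k : nat) (a c : R) (n : nat) : R :=
  (a - 1)^-1 * (meixner a^-1 (- c + 1) k.+1).[- n%:R].

Definition gamma_ (R : realType) (k : nat) (a c : R) (n : nat) : R :=
  (meixner a^-1 (- c + 2) k).[- n%:R].

Definition beta_ (R : realType) (k : nat) (a c : R) (n : nat) : R :=
  - (gamma_ k a c n.+1 / gamma_ k a c n).

Definition q_ (R : realType) (k : nat) (a c : R) (n : nat) : {poly R} :=
  if n is n'.+1 then meixner a c n + beta_ k a c n *: meixner a c n' else 1.

Definition P1 (R : realType) (k : nat) (a c : R) : {poly R} :=
  (a - 1)^-1 *: (meixner a^-1 (- c + 1) k.+1 \Po (- ((a - 1)^-1 *: 'X))).

Definition P2 (R : realType) (k : nat) (a c : R) : {poly R} :=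
  meixner a^-1 (- c + 2) k \Po (- ((a - 1)^-1 *: 'X) - 1).

Definition D_op (R : realType) (k : nat) (a c : R) (f : {poly R}) : {poly R} :=
  op_poly (P1 k a c) (meixner_op a c) f
  + (a / (1 - a)) *: Delta (op_poly (P2 k a c) (meixner_op a c) f).

(* Main.v *)
Require Import Defs.
From HB Require Import structures.
From mathcomp Require Import all_boot all_order all_algebra.
From mathcomp Require Import all_classical all_reals all_analysis.
From mathcomp Require Import ring.
Set Implicit Arguments.
Unset Strict Implicit.
Unset Printing Implicit Defensive.
Import Order.TTheory GRing.Theory Num.Theory.
Import numFieldNormedType.Exports.
Local Open Scope ring_scope.

(** Write m_n^c for [meixner a c n]. Everything rests on three relations between
   the parameters c and c + 1, visible on the generating function
   sum_n m_n^c t^n = (1 - t/a)^x (1 - t)^(-x-c):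
   m_n^c = m_n^(c+1) - m_(n-1)^(c+1) ([meixner_cS]), the forward shift
   Delta m_n^c = (1 - 1/a) m_(n-1)^(c+1) ([Delta_meixner]) and the backward
   shift ([meixner_raise]).

   Eigenfunctions. [meixner_op] is a first order operator applied to Delta, so
   the two shifts give its eigenvalues n (a - 1) on m_n^c. Hence P1 and P2 act
   on m_n^c as lambda_n and gamma_(n+1), and
   D m_n = lambda_n m_n - gamma_(n+1) m_(n-1)^(c+1). In the combination
   q_n = m_n + beta_n m_(n-1) the terms of parameter c + 1 recombine into
   m_(n-1)^c because beta_n gamma_n = - gamma_(n+1), and what is left is
   lambda_n q_n because lambda_n - lambda_(n-1) = gamma_n ([lambdaS]).

   Genre. Each application of [meixner_op] widens the range of shifts by one on
   both sides and raises by one the degree of the two extreme coefficients.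
   P1 contributes extreme coefficients of degree k + 1; the term with P2 reaches
   only the top shift, with degree k, and cannot cancel it ([D_op_banded]).

   Orthogonality. No measure is available for general a and c, but a functional
   that kills all m_n^c with n > 0 satisfies the Pearson equation [pearson],
   which is the backward shift in dual form. Conversely that equation gives an
   integration by parts ([pearson_lower]), hence the orthogonality of the m_n^c.
   Multiplying the functional by X + c raises its parameter by one. So, for
   rho of parameter d = c - k - 1, the functional (X + d) rho_tilde has
   parameter c, and q_n is orthogonal for rho_tilde to every multiple of X + d
   of degree < n: only rho_tilde(q_n) = 0 remains, together with beta_n <> 0 for
   the norms. Integrating by parts n times against the factor
   (X + d + 1) ... (X + d + k) of rho_tilde turns rho_tilde(m_n^c) into
   rho((X + d + n + 1) ... (X + d + n + k)) ([rising_meixner]), and as a function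
   of n this moment is a constant times gamma_(n+1) ([rising_moment]); beta_n is
   exactly the ratio that makes rho_tilde(q_n) vanish. *)

(** * Shift operators *)

Lemma shift_op_is_linear (R : realType) (l : int) : linear (@shift_op R l).
Proof. by move=> u p q; rewrite /shift_op linearP. Qed.

HB.instance Definition _ (R : realType) (l : int) :=
  GRing.isLinear.Build R {poly R} {poly R} *:%R (@shift_op R l)
    (shift_op_is_linear l).

Lemma shift_opM (R : realType) (l : int) (p q : {poly R}) :
  shift_op l (p * q) = shift_op l p * shift_op l q.
Proof. by rewrite /shift_op comp_polyM. Qed.

Lemma shift_op0 (R : realType) (p : {poly R}) : shift_op 0 p = p.
Proof. by rewrite /shift_op addr0 comp_polyXr. Qed.

Lemma shift_op_comp (R : realType) (l l' : int) (p : {poly R}) :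
  shift_op l (shift_op l' p) = shift_op (l + l') p.
Proof.
rewrite /shift_op -comp_polyA comp_polyD comp_polyX comp_polyC.
by rewrite rmorphD polyCD addrA.
Qed.

Lemma shift_opXD (R : realType) (l : int) (c : R) :
  shift_op l ('X + c%:P) = 'X + (c + l%:~R)%:P.
Proof. by rewrite /shift_op comp_polyD comp_polyX comp_polyC polyCD; ring. Qed.

Lemma shift_opX (R : realType) (l : int) :
  shift_op l ('X : {poly R}) = 'X + (l%:~R)%:P.
Proof. by rewrite /shift_op comp_polyX. Qed.

Lemma shift_opC (R : realType) (l : int) (c : R) : shift_op l c%:P = c%:P.
Proof. by rewrite /shift_op comp_polyC. Qed.

Lemma shift_op1 (R : realType) (l : int) : shift_op l (1 : {poly R}) = 1.
Proof. exact: shift_opC. Qed.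

Lemma size_shift_op (R : realType) (l : int) (p : {poly R}) :
  size (shift_op l p) = size p.
Proof. by rewrite /shift_op size_comp_poly2 // size_XaddC. Qed.

Lemma lead_coef_shift_op (R : realType) (l : int) (p : {poly R}) :
  lead_coef (shift_op l p) = lead_coef p.
Proof.
by rewrite /shift_op lead_coef_comp ?size_XaddC // lead_coefXaddC expr1n mulr1.
Qed.

Lemma Delta_is_linear (R : realType) : linear (@Delta R).
Proof. by move=> u p q; rewrite /Delta linearP scalerBr opprD addrACA. Qed.

HB.instance Definition _ (R : realType) :=
  GRing.isLinear.Build R {poly R} {poly R} *:%R (@Delta R)
    (@Delta_is_linear R).

Lemma meixner_op_is_linear (R : realType) (a c : R) :
  linear (@meixner_op R a c).
Proof.
move=> u p q; rewrite /meixner_op !linearP /= -!mul_polyC; ring.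
Qed.

HB.instance Definition _ (R : realType) (a c : R) :=
  GRing.isLinear.Build R {poly R} {poly R} *:%R (@meixner_op R a c)
    (meixner_op_is_linear a c).

(** * Binomial polynomials *)

Lemma binom_poly0 (R : realType) (p : {poly R}) : binom_poly p 0 = 1.
Proof. by rewrite /binom_poly big_ord0 fact0 invr1 scale1r. Qed.

Lemma binom_polyS (R : realType) (p : {poly R}) (j : nat) :
  j.+1%:R *: binom_poly p j.+1 = (p - (j%:R)%:P) * binom_poly p j.
Proof.
rewrite /binom_poly big_ord_recr /= scalerA factS natrM invfM mulrA divff.
  by rewrite mul1r -!mul_polyC; ring.
by rewrite pnatr_eq0.
Qed.

Lemma binom_poly_absorb (R : realType) (p : {poly R}) (j : nat) :
  p * binom_poly (p - 1) j = j.+1%:R *: binom_poly p j.+1.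
Proof.
elim: j => [|j IH]; first by rewrite binom_polyS !binom_poly0 subr0.
have nz : (j.+1%:R : R) != 0 by rewrite pnatr_eq0.
apply: (scalerI nz).
rewrite scalerAr (binom_polyS (p - 1)) mulrCA IH -scalerAr (binom_polyS p).
by congr (_ *: (_ * _)); rewrite -natr1 polyCD; ring.
Qed.

Lemma binom_poly_pascal (R : realType) (p : {poly R}) (j : nat) :
  binom_poly (p + 1) j.+1 = binom_poly p j.+1 + binom_poly p j.
Proof.
have nz : (j.+1%:R : R) != 0 by rewrite pnatr_eq0.
apply: (scalerI nz); rewrite -binom_poly_absorb scalerDr binom_polyS addrK.
by rewrite -mul_polyC -natr1 polyCD; ring.
Qed.

Lemma shift_binom_poly (R : realType) (l : int) (p : {poly R}) (j : nat) :
  shift_op l (binom_poly p j) = binom_poly (shift_op l p) j.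
Proof.
elim: j => [|j IH]; first by rewrite !binom_poly0 shift_op1.
have nz : (j.+1%:R : R) != 0 by rewrite pnatr_eq0.
apply: (scalerI nz).
have := congr1 (shift_op l) (binom_polyS p j); rewrite linearZ /= => ->.
by rewrite shift_opM linearB /= shift_opC IH binom_polyS.
Qed.

(** * Meixner polynomials *)

Lemma meixner0 (R : realType) (a c : R) : meixner a c 0 = 1.
Proof.
by rewrite /meixner big_ord1 !binom_poly0 expr0 invr1 mulr1 !scale1r.
Qed.

(** Passing from c + 1 to c multiplies the generating function by 1 - t, that
   is, applies Pascal's rule to the second binomial factor of every term. *)
Lemma meixner_cS (R : realType) (a c : R) (n : nat) :
  meixner a c n.+1 = meixner a (c + 1) n.+1 - meixner a (c + 1) n.
Proof.
rewrite /meixner exprS mulN1r -!scaleNr -scalerDr.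
(* Pascal's rule fails in the last term, whose second factor is binomial(_, 0). *)
rewrite big_ord_recr [in RHS]big_ord_recr /= subnn !binom_poly0.
congr (_ *: _); rewrite addrAC; congr (_ + _).
rewrite -big_split /=; apply: eq_bigr => j _.
rewrite -scalerDr -mulrDr; congr (_ *: (_ * _)).
have -> : - 'X - c%:P = - 'X - (c + 1)%:P + 1 by rewrite polyCD; ring.
by rewrite subSn ?binom_poly_pascal // -ltnS.
Qed.

Lemma shift_NXB (R : realType) (l : int) (c : R) :
  shift_op l (- 'X - c%:P) = - 'X - (c + l%:~R)%:P.
Proof. by rewrite -opprD linearN /= shift_opXD opprD. Qed.

(** Replacing x by x + 1 multiplies the generating function by
   (1 - t/a) / (1 - t), and (1 - t/a) / (1 - t) - 1 = (1 - 1/a) t / (1 - t). *)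
Lemma Delta_meixner (R : realType) (a c : R) (n : nat) :
  Delta (meixner a c n.+1) = (1 - a^-1) *: meixner a (c + 1) n.
Proof.
suff E : shift_op 1 (meixner a c n.+1)
    = meixner a (c + 1) n.+1 - a^-1 *: meixner a (c + 1) n.
  by rewrite /Delta {}E (meixner_cS a c) scalerBl scale1r; ring.
rewrite /meixner linearZ /= linear_sum /= exprS mulN1r !scaleNr scalerA.
rewrite [a^-1 * _]mulrC -scalerA.
apply: oppr_inj; rewrite [RHS]opprB !opprK [RHS]addrC -scalerDr; congr (_ *: _).
rewrite big_ord_recl [X in _ = X + _]big_ord_recl -[RHS]addrA /=.
have shiftF j : shift_op 1 (binom_poly (- 'X - c%:P) j)
    = binom_poly (- 'X - (c + 1)%:P) j.
  by rewrite shift_binom_poly shift_NXB.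
rewrite linearZ /= shift_opM shiftF shift_binom_poly !binom_poly0.
congr (_ + _); rewrite scaler_sumr -big_split /=; apply: eq_bigr => j _.
rewrite linearZ /= shift_opM shiftF shift_binom_poly /bump /= add1n subSS.
rewrite shift_opX binom_poly_pascal.
by rewrite mulrDl scalerDr exprS invfM scalerA.
Qed.

(** With G_c the generating function of parameter c, this is
   - a dG_c/dt = x G_(c+1)(x - 1) - a (x + c) G_(c+1)(x), the product rule for
   (1 - t/a)^x (1 - t)^(-x-c). On coefficients, the two terms contribute the
   weights j and n + 1 - j to the j-th summand of [meixner a c n.+1]. *)
Lemma meixner_raise (R : realType) (a c : R) (n : nat) : a != 0 ->
  'X * shift_op (-1) (meixner a (c + 1) n)
    - a *: (('X + c%:P) * meixner a (c + 1) n)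
  = (- (a * n.+1%:R)) *: meixner a c n.+1.
Proof.
move=> a0; rewrite /meixner.
pose b j : {poly R} := binom_poly 'X j.
pose e j := binom_poly (- 'X - c%:P) j.
have up j : 'X * shift_op (-1) (b j) = j.+1%:R *: b j.+1.
  by rewrite shift_binom_poly shift_opX rmorphN1 binom_poly_absorb.
have shiftF j : shift_op (-1) (binom_poly (- 'X - (c + 1)%:P) j) = e j.
  by rewrite shift_binom_poly shift_NXB rmorphN1 addrK.
have upF j : ('X + c%:P) * binom_poly (- 'X - (c + 1)%:P) j
    = - (j.+1%:R *: e j.+1).
  have -> : - 'X - (c + 1)%:P = - 'X - c%:P - 1 by rewrite polyCD; ring.
  by rewrite /e -binom_poly_absorb; ring.
set S := \sum_(j < n.+1) _; set S' := \sum_(j < n.+2) _.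
suff E : 'X * shift_op (-1) S - a *: (('X + c%:P) * S) = (a * n.+1%:R) *: S'.
  rewrite linearZ /= -!scalerAr scalerA [a * _]mulrC -scalerA -scalerBr E.
  rewrite !scalerA exprS; by congr (_ *: _); ring.
rewrite {}/S {}/S' linear_sum mulr_sumr mulr_sumr.
pose t j := a ^- j *: (b j * e (n.+1 - j)%N).
rewrite (eq_bigr (fun j : 'I_n.+1 => (a * j.+1%:R) *: t j.+1)); last first.
  move=> j _; rewrite linearZ /= shift_opM shiftF -scalerAr mulrA up.
  rewrite /t subSS -scalerAl !scalerA; congr (_ *: _).
  by rewrite exprS invfM; field; rewrite expf_neq0.
rewrite [X in _ - a *: X](eq_bigr
    (fun j : 'I_n.+1 => - ((n.+1 - j)%:R *: t j))); last first.
  move=> j _; rewrite -scalerAr mulrCA upF /t subSn ?leq_ord //.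
  by rewrite mulrN scalerN -scalerAr !scalerA mulrC.
rewrite sumrN scalerN opprK.
pose u j := (a * j%:R) *: t j; pose v j := (a * (n.+1 - j)%:R) *: t j.
have -> : \sum_(j < n.+1) (a * j.+1%:R) *: t j.+1 = \sum_(j < n.+2) u j.
  by rewrite [RHS]big_ord_recl {1}/u /= mulr0 scale0r add0r; apply: eq_bigr.
have -> : a *: (\sum_(j < n.+1) (n.+1 - j)%:R *: t j) = \sum_(j < n.+2) v j.
  rewrite [RHS]big_ord_recr {2}/v /= subnn mulr0 scale0r addr0 scaler_sumr.
  by apply: eq_bigr => j _; rewrite scalerA.
rewrite -big_split scaler_sumr; apply: eq_bigr => j _ /=.
by rewrite /u /v -scalerDl -mulrDr -natrD subnKC // -ltnS.
Qed.

(** The operator factors through the forward difference, which turns the two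
   shift relations into the eigenvalue equation. *)
Lemma meixner_opE (R : realType) (a c : R) (p : {poly R}) :
  meixner_op a c p
  = a *: (('X + c%:P) * Delta p) - 'X * shift_op (-1) (Delta p).
Proof.
rewrite /Delta /meixner_op linearB /= shift_op_comp !shift_op0 -!mul_polyC.
by rewrite polyCM polyCD; ring.
Qed.

Lemma Delta1 (R : realType) : Delta (1 : {poly R}) = 0.
Proof. by rewrite /Delta shift_op1 subrr. Qed.

Lemma meixner_op_meixner (R : realType) (a c : R) (n : nat) : a != 0 ->
  meixner_op a c (meixner a c n) = (n%:R * (a - 1)) *: meixner a c n.
Proof.
move=> a0; rewrite meixner_opE; case: n => [|n].
  by rewrite meixner0 Delta1 linear0 !mulr0 scaler0 subr0 mul0r scale0r.
have := meixner_raise c n a0; rewrite Delta_meixner.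
(* [meixner] is generalized, here and below, to keep the lemmas on scaling from
   unfolding it down to its sign. *)
move: (meixner a (c + 1) n) => m E.
transitivity ((a^-1 - 1) *: ('X * shift_op (-1) m - a *: (('X + c%:P) * m))).
  by rewrite linearZ /= -!mul_polyC !polyCB; ring.
by rewrite E scalerA; congr (_ *: _); field.
Qed.

(** In the backward shift the leading coefficient is multiplied by 1 - a. *)
Lemma size_meixner (R : realType) (a c : R) (n : nat) : a != 0 -> a != 1 ->
  size (meixner a c n) = n.+1.
Proof.
move=> a0 a1; elim: n c => [|n IH] c; first by rewrite meixner0 size_poly1.
have nz : - (a * n.+1%:R) != 0 by rewrite oppr_eq0 mulf_neq0 ?pnatr_eq0.
rewrite -(size_scale _ nz) -meixner_raise //.
set m := meixner _ _ _.
have sm : size m = n.+1 by exact: IH.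
have m0 : m != 0 by rewrite -size_poly_eq0 sm.
have -> : 'X * shift_op (-1) m - a *: (('X + c%:P) * m)
   = 'X * (shift_op (-1) m - a *: m) - (a * c) *: m.
  by rewrite -!mul_polyC polyCM; ring.
set d := _ - a *: m.
have sd : size d = n.+1.
  apply/eqP; rewrite eqn_leq; apply/andP; split.
    rewrite (leq_trans (size_polyD _ _)) // size_polyN geq_max size_shift_op sm.
    by rewrite leqnn (leq_trans (size_scale_leq _ _)) // sm.
  rewrite ltnNge; apply/negP => /leq_sizeP/(_ n (leqnn n))/eqP; apply/negP.
  rewrite coefB coefZ.
  have -> : (shift_op (-1) m)`_n = m`_n.
    by have := lead_coef_shift_op (-1) m; rewrite !lead_coefE size_shift_op sm.
  rewrite -{1}[m`_n]mul1r -mulrBl mulf_neq0 //.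
    by rewrite subr_eq0 eq_sym.
  by move: m0; rewrite -lead_coef_eq0 lead_coefE sm.
have d0 : d != 0 by rewrite -size_poly_eq0 sd.
have sXd : size ('X * d) = n.+2 by rewrite mulrC size_mulX // sd.
rewrite size_polyDl sXd // size_polyN ltnS.
by rewrite (leq_trans (size_scale_leq _ _)) // sm.
Qed.

Lemma poly_basis (R : fieldType) (b : nat -> {poly R}) (n : nat)
    (p : {poly R}) :
  (forall j, size (b j) = j.+1) -> (size p <= n)%N ->
  exists s : nat -> R, p = \sum_(j < n) s j *: b j.
Proof.
move=> sb; elim: n p => [|n IH] p sp.
  exists (fun=> 0); rewrite big_ord0; apply/eqP; rewrite -size_poly_eq0.
  by rewrite -leqn0.
have bn0 : (b n)`_n != 0.
  have : b n != 0 by rewrite -size_poly_eq0 sb.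
  by rewrite -lead_coef_eq0 lead_coefE sb.
have [|s Es] := IH (p - (p`_n / (b n)`_n) *: b n).
  apply/leq_sizeP => j; rewrite leq_eqVlt => /predU1P[<-|nj].
    by rewrite coefB coefZ divfK // subrr.
  have pj : p`_j = 0 by rewrite nth_default // (leq_trans sp nj).
  have bj : (b n)`_j = 0 by rewrite nth_default // sb.
  by rewrite coefB coefZ pj bj mulr0 subrr.
exists (fun j => if (j < n)%N then s j else p`_n / (b n)`_n).
rewrite big_ord_recr /= ltnn -[LHS](subrK ((p`_n / (b n)`_n) *: b n)) Es.
by congr (_ + _); apply: eq_bigr => j _; rewrite ltn_ord.
Qed.

(** * Functionals with a Pearson equation *)

(** For mu given by weights w(x) = a^x Gamma(x + c) / x! on the nonnegative
   integers, this is the recurrence (x + 1) w(x + 1) = a (x + c) w(x). *)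
Definition pearson (R : realType) (a c : R) (mu : {scalar {poly R}}) : Prop :=
  forall p, mu ('X * shift_op (-1) p) = a * mu (('X + c%:P) * p).

(** By the backward shift relation the Pearson equation at the basis
   [meixner a (c + 1) n] says that [mu] kills [meixner a c n.+1]. *)
Lemma pearson_of_orthogonal (R : realType) (a c : R) (mu : {scalar {poly R}}) :
  a != 0 -> a != 1 -> (forall n, mu (meixner a c n.+1) = 0) -> pearson a c mu.
Proof.
move=> a0 a1 mu0 p.
have sm j : size (meixner a (c + 1) j) = j.+1 by exact: size_meixner.
have [s ->] := poly_basis sm (leqnn (size p)).
rewrite linear_sum /= !mulr_sumr !linear_sum mulr_sumr /=.
apply: eq_bigr => j _.
have := meixner_raise c j a0; move: (meixner a (c + 1) j) => m E.
rewrite linearZ /= -!scalerAr !linearZ /= mulrCA; congr (_ * _).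
apply/eqP; rewrite -subr_eq0 -[a * _]linearZ -linearB /= E.
by rewrite scalarZ mu0 mulr0.
Qed.

Lemma pearson_mul (R : realType) (a c : R) (mu : {scalar {poly R}}) :
  pearson a c mu -> pearson a (c + 1) (mul_functional ('X + c%:P) mu).
Proof.
move=> mu_p p; rewrite /= /mul_functional mulrCA.
transitivity (mu ('X * shift_op (-1) (('X + (c + 1)%:P) * p))).
  by rewrite shift_opM shift_opXD rmorphN1 addrK.
by rewrite mu_p.
Qed.

(** The Pearson equation at the constant 1. *)
Lemma pearson_mass (R : realType) (a c : R) (mu : {scalar {poly R}}) :
  a != 1 -> pearson a c mu -> mu ('X + c%:P) = c / (1 - a) * mu 1.
Proof.
move=> a1 /(_ 1); rewrite shift_op1 !mulr1 => E.
have a1' : 1 - a != 0 by rewrite subr_eq0 eq_sym.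
have Ec : mu c%:P = c * mu 1 by rewrite -alg_polyC linearZ.
apply: (mulfI a1'); rewrite mulrBl mul1r -E linearD /= Ec.
by rewrite addrAC subrr add0r; field.
Qed.

(** Integration by parts: expand [meixner a c n.+1] by the backward shift, and
   move the shift onto [p] with the Pearson equation. *)
Lemma pearson_lower (R : realType) (a c : R) (mu : {scalar {poly R}})
    (n : nat) (p : {poly R}) :
  a != 0 -> pearson a c mu ->
  mu (meixner a c n.+1 * p)
  = - (n.+1%:R)^-1 * mul_functional ('X + c%:P) mu
                       (meixner a (c + 1) n * Delta p).
Proof.
move=> a0 mu_p; have nz : - (a * n.+1%:R) != 0.
  by rewrite oppr_eq0 mulf_neq0 ?pnatr_eq0.
apply: (mulfI nz); rewrite -[LHS]linearZ /= scalerAl.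
move: (meixner a (c + 1) n) (meixner_raise c n a0) => m <-.
have n0 : (n.+1%:R : R) != 0 by rewrite pnatr_eq0.
rewrite mulrBl linearB /=.
have -> : 'X * shift_op (-1) m * p = 'X * shift_op (-1) (m * shift_op 1 p).
  by rewrite shift_opM shift_op_comp addNr shift_op0 mulrA.
rewrite mu_p -scalerAl scalarZ /= -mulrBr -linearB /= /mul_functional.
have -> : ('X + c%:P) * (m * shift_op 1 p) - ('X + c%:P) * m * p
   = ('X + c%:P) * (m * Delta p) by rewrite /Delta; ring.
by field.
Qed.

(** On the basis p = m_j with j < n, each integration by parts lowers both
   degrees by one while c becomes c + 1, and ends on Delta 1 = 0. *)
Lemma pearson_orthogonal (R : realType) (a c : R) (mu : {scalar {poly R}})
    (n : nat) (p : {poly R}) :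
  a != 0 -> a != 1 -> pearson a c mu -> (size p <= n)%N ->
  mu (meixner a c n * p) = 0.
Proof.
move=> a0 a1 mu_p sp.
have [s ->] := poly_basis (fun j => size_meixner c j a0 a1) sp.
rewrite mulr_sumr linear_sum big1 // => -[j jn] _ /=.
rewrite -scalerAr scalarZ; apply/eqP; rewrite mulf_eq0; apply/orP; right.
elim: n j c mu mu_p jn {sp s} => // n IH [|j] c mu mu_p jn.
  by rewrite pearson_lower // meixner0 Delta1 mulr0 linear0 mulr0.
rewrite pearson_lower // Delta_meixner -scalerAr scalarZ /=.
by rewrite (eqP (IH _ _ _ (pearson_mul mu_p) jn)) !mulr0.
Qed.

(** The same descent as for [pearson_orthogonal], from j = n, ends on the mass of
   (X + c) ... (X + c + n - 1) mu, to which every step contributes a factor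
   c + j by [pearson_mass]. *)
Lemma pearson_norm (R : realType) (a c : R) (mu : {scalar {poly R}})
    (n : nat) (p : {poly R}) :
  a != 0 -> a != 1 -> (forall j : nat, c + j%:R != 0) -> mu 1 != 0 ->
  pearson a c mu -> size p = n.+1 -> mu (meixner a c n * p) != 0.
Proof.
move=> a0 a1 c0 mu1 mu_p sp.
have sm j : size (meixner a c j) = j.+1 by exact: size_meixner.
have sp' : (size p <= n.+1)%N by rewrite sp.
have [s Ep] := poly_basis sm sp'.
have sn : s n != 0.
  apply/eqP => sn; suff : (size p <= n)%N by rewrite sp ltnn.
  move: Ep; rewrite big_ord_recr /= sn scale0r addr0 => ->.
  rewrite (leq_trans (size_sum _ _ _)) //; apply/bigmax_leqP => j _.
  by rewrite (leq_trans (size_scale_leq _ _)) // sm.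
rewrite Ep big_ord_recr mulrDr linearD /=.
rewrite [X in X + _]pearson_orthogonal // ?add0r; last first.
  rewrite (leq_trans (size_sum _ _ _)) //; apply/bigmax_leqP => j _.
  by rewrite (leq_trans (size_scale_leq _ _)) // sm.
rewrite -scalerAr scalarZ mulf_neq0 //=.
elim: n c mu c0 mu1 mu_p {p sp sm sp' s Ep sn} => [|n IH] c mu c0 mu1 mu_p.
  by rewrite meixner0 mulr1.
rewrite pearson_lower // Delta_meixner -scalerAr scalarZ /=.
rewrite mulf_neq0 ?oppr_eq0 ?invr_eq0 ?pnatr_eq0 // mulf_neq0 //.
  by rewrite subr_eq0 eq_sym invr_eq1.
apply: IH; last exact: pearson_mul.
  by move=> j; rewrite -addrA nat1r.
rewrite /= /mul_functional mulr1 (pearson_mass a1 mu_p).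
rewrite mulf_neq0 // mulf_neq0 //.
  by have := c0 0; rewrite addr0.
by rewrite invr_eq0 subr_eq0 eq_sym.
Qed.

(** * Rising factorials *)

Definition rising (R : realType) (c : R) (k : nat) : {poly R} :=
  \prod_(i < k) ('X + (c + i%:R)%:P).

Lemma rising_recl (R : realType) (c : R) (k : nat) :
  rising c k.+1 = ('X + c%:P) * rising (c + 1) k.
Proof.
rewrite /rising big_ord_recl addr0; congr (_ * _).
by apply: eq_bigr => i _; rewrite -addrA nat1r.
Qed.

Lemma rising_recr (R : realType) (c : R) (k : nat) :
  rising c k.+1 = rising c k * ('X + (c + k%:R)%:P).
Proof. by rewrite /rising big_ord_recr. Qed.

Lemma shift_rising (R : realType) (c : R) (k : nat) :
  shift_op (-1) (rising (c + 1) k) = rising c k.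
Proof.
elim: k => [|k IH]; first by rewrite /rising !big_ord0 shift_op1.
rewrite !rising_recr shift_opM IH shift_opXD rmorphN1.
by congr (_ * ('X + _%:P)); ring.
Qed.

Lemma pearson_rising (R : realType) (a c : R) (mu : {scalar {poly R}})
    (n : nat) :
  pearson a c mu -> pearson a (c + n%:R) (mul_functional (rising c n) mu).
Proof.
elim: n c mu => [|n IH] c mu mu_p p.
  by rewrite /= /mul_functional /rising big_ord0 !mul1r addr0; apply: mu_p.
have := IH _ _ (pearson_mul mu_p) p; rewrite /= /mul_functional.
by rewrite rising_recl !mulrA -[c + 1 + _]addrA nat1r.
Qed.

Lemma rising_mass (R : realType) (a c : R) (mu : {scalar {poly R}}) (n : nat) :
  a != 1 -> pearson a c mu ->
  mu (rising c n) = (\prod_(i < n) (c + i%:R)) / (1 - a) ^+ n * mu 1.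
Proof.
move=> a1 mu_p; elim: n => [|n IH].
  by rewrite /rising !big_ord0 expr0 invr1 !mul1r.
have := pearson_mass a1 (pearson_rising n mu_p).
rewrite /= /mul_functional mulr1 -rising_recr => ->.
by rewrite IH big_ord_recr exprSr invfM /=; ring.
Qed.

(** Integrating by parts against a rising factorial: the Pearson equation
   replaces [X + c] by [X + e], and the difference of the two is constant. *)
Lemma rising_meixner_step (R : realType) (a c e : R) (mu : {scalar {poly R}})
    (k n : nat) : a != 0 -> pearson a c mu ->
  n.+1%:R * mu (rising e k * meixner a (e + k%:R) n.+1)
  = (e - c) * mu (rising (e + 1) k * meixner a (e + 1 + k%:R) n).
Proof.
move=> a0 mu_p; have Na0 : - a != 0 by rewrite oppr_eq0.
apply: (mulfI Na0).
have := meixner_raise (e + k%:R) n a0; rewrite [e + _ + 1]addrAC.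
move: (meixner a (e + 1 + _) n) => m E.
rewrite mulrA mulNr -scalarZ scalerAr -E mulrBr linearB /=.
have -> : rising e k * ('X * shift_op (-1) m)
    = 'X * shift_op (-1) (rising (e + 1) k * m).
  by rewrite shift_opM shift_rising mulrCA.
have -> : rising e k * (a *: (('X + (e + k%:R)%:P) * m))
    = a *: (('X + e%:P) * (rising (e + 1) k * m)).
  by rewrite -scalerAr [in LHS]mulrA -rising_recr rising_recl -mulrA.
rewrite mu_p scalarZ -mulrBr -linearB /=.
have -> : ('X + c%:P) * (rising (e + 1) k * m)
    - ('X + e%:P) * (rising (e + 1) k * m)
   = (c - e) *: (rising (e + 1) k * m) by rewrite -mul_polyC polyCB; ring.
by rewrite scalarZ; ring.
Qed.

(** After n steps no Meixner polynomial is left. *)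
Lemma rising_meixner (R : realType) (a c : R) (mu : {scalar {poly R}})
    (k n j : nat) : a != 0 -> pearson a c mu ->
  (n`! * j`!)%:R
    * mu (rising (c + j.+1%:R) k * meixner a (c + j.+1%:R + k%:R) n)
  = (j + n)`!%:R * mu (rising (c + (j + n).+1%:R) k).
Proof.
move=> a0 mu_p; elim: n j => [|n IH] j.
  by rewrite meixner0 mulr1 fact0 mul1n addn0.
rewrite factS -mulnA mulnC natrM -mulrA (rising_meixner_step _ _ _ a0 mu_p).
have -> : c + j.+1%:R - c = j.+1%:R by ring.
rewrite mulrA -natrM -mulnA [(j`! * _)%N]mulnC -factS.
have -> : c + j.+1%:R + 1 = c + j.+2%:R by rewrite -addrA natr1.
by rewrite IH addSnnS.
Qed.

Lemma horner_binom_poly (R : realType) (p : {poly R}) (j : nat) (x : R) :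
  (binom_poly p j).[x] = (j`!%:R)^-1 * \prod_(i < j) (p.[x] - i%:R).
Proof.
rewrite /binom_poly hornerZ horner_prod; congr (_ * _).
by apply: eq_bigr => i _; rewrite hornerD hornerN hornerC.
Qed.

Lemma horner_meixner0 (R : realType) (a c : R) (n : nat) :
  (meixner a c n).[0] = (\prod_(i < n) (c + i%:R)) / n`!%:R.
Proof.
rewrite /meixner hornerZ horner_sum big_ord_recl /= big1 ?addr0; last first.
  move=> j _; rewrite hornerZ hornerM horner_binom_poly big_ord_recl.
  by rewrite hornerX subrr mul0r mulr0 mul0r mulr0.
rewrite binom_poly0 mul1r expr0 invr1 scale1r subn0 horner_binom_poly.
rewrite mulrCA mulrC; congr (_ / _).
rewrite -{1}(card_ord n) -prodrN; apply: eq_bigr => i _.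
by rewrite hornerD !hornerN hornerX hornerC; ring.
Qed.

Lemma horner_Delta (R : realType) (p : {poly R}) (x : R) :
  (Delta p).[x] = p.[x + 1] - p.[x].
Proof. by rewrite /Delta /shift_op !hornerE horner_comp !hornerE. Qed.

(** Duality: both sides satisfy the same first order difference equation in
   [y] (linking [k] to [k.+1]) and agree at [y = 0]. *)
Lemma rising_moment (R : realType) (a c : R) (mu : {scalar {poly R}})
    (k y : nat) : a != 0 -> a != 1 -> pearson a c mu ->
  mu (rising (c + y%:R) k)
  = k`!%:R / (a - 1) ^+ k * mu 1 * (meixner a^-1 (1 - c - k%:R) k).[- y%:R].
Proof.
move=> a0 a1 mu_p; have a1' : a - 1 != 0 by rewrite subr_eq0.
have a1'' : 1 - a != 0 by rewrite subr_eq0 eq_sym.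
elim: k y => [|k IHk] y.
  rewrite meixner0 hornerC /rising big_ord0 fact0 expr0 invr1; ring.
have kf : (k.+1`!%:R : R) != 0 by rewrite pnatr_eq0 -lt0n fact_gt0.
elim: y => [|y IHy].
  rewrite addr0 oppr0 horner_meixner0 (rising_mass _ a1 mu_p).
  have -> : \prod_(i < k.+1) (1 - c - k.+1%:R + i%:R)
      = (-1) ^+ k.+1 * \prod_(i < k.+1) (c + i%:R).
    rewrite (reindex_inj rev_ord_inj) -[X in _ ^+ X](card_ord k.+1) -prodrN.
    apply: eq_bigr => i _ /=; rewrite subSS natrB ?leq_ord // -natr1; ring.
  have -> : 1 - a = -1 * (a - 1) by ring.
  rewrite exprMn invfM -exprVn invrN1; field.
  by rewrite kf expf_neq0.
have -> : rising (c + y.+1%:R) k.+1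
    = rising (c + y%:R) k.+1 + k.+1%:R *: rising (c + y.+1%:R) k.
  rewrite rising_recr rising_recl -mul_polyC -[c + y%:R + 1]addrA natr1.
  by rewrite -!natr1 !polyCD; ring.
rewrite linearD /= scalarZ IHy IHk; set M := meixner _ _ k.+1.
have dM : M.[- y%:R] - M.[- y.+1%:R]
    = (1 - a) * (meixner a^-1 (1 - c - k%:R) k).[- y.+1%:R].
  have -> : - y%:R = - y.+1%:R + 1 :> R by rewrite -natr1; ring.
  rewrite -horner_Delta Delta_meixner invrK hornerZ.
  by have -> : 1 - c - k.+1%:R + 1 = 1 - c - k%:R by rewrite -natr1; ring.
have -> : M.[- y%:R] = M.[- y.+1%:R]
   + (1 - a) * (meixner a^-1 (1 - c - k%:R) k).[- y.+1%:R].
  by rewrite -dM; ring.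
by rewrite factS natrM exprS invfM; field; rewrite a1' expf_neq0.
Qed.

(** * Orthogonality *)

Lemma rho_tildeE (R : realType) (k : nat) (c : R) (rho : {scalar {poly R}})
    (p : {poly R}) :
  rho_tilde k c rho p = rho (rising (c - k%:R) k * p).
Proof.
rewrite /rho_tilde /= /mul_functional; congr (rho (_ * _)).
rewrite big_add1 /= big_mkord (reindex_inj rev_ord_inj).
apply: eq_bigr => i _ /=; congr ('X + _%:P).
by rewrite subnSK // natrB 1?ltnW //; ring.
Qed.

Lemma rho_tilde_meixner (R : realType) (k : nat) (a c : R)
    (rho : {scalar {poly R}}) (n : nat) :
  a != 0 -> a != 1 -> pearson a (c - k%:R - 1) rho ->
  rho_tilde k c rho (meixner a c n)
  = k`!%:R / (a - 1) ^+ k * rho 1 * gamma_ k a c n.+1.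
Proof.
move=> a0 a1 rho_p.
have nz : (n`!%:R : R) != 0 by rewrite pnatr_eq0 -lt0n fact_gt0.
apply: (mulfI nz); rewrite rho_tildeE.
have := rising_meixner k n 0 a0 rho_p.
have -> : c - k%:R - 1 + 1 = c - k%:R by ring.
rewrite subrK fact0 muln1 add0n => ->; congr (_ * _).
rewrite (rising_moment _ _ a0 a1 rho_p) /gamma_; congr (_ * _).
by have -> : 1 - (c - k%:R - 1) - k%:R = - c + 2 by ring.
Qed.

(** [pearson_rising] in the form used for the functional (X + d) rho_tilde, with
   d = c - k - 1. *)
Lemma pearson_rising_shift (R : realType) (k : nat) (a c : R)
    (rho : {scalar {poly R}}) :
  pearson a (c - k%:R - 1) rho ->
  pearson a c (mul_functional (rising (c - k%:R - 1) k.+1) rho).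
Proof.
move=> /(pearson_rising k.+1).
by have -> : c - k%:R - 1 + k.+1%:R = c by rewrite -natr1; ring.
Qed.

Lemma size_q (R : realType) (k : nat) (a c : R) (n : nat) :
  a != 0 -> a != 1 -> size (q_ k a c n) = n.+1.
Proof.
move=> a0 a1; case: n => [|n]; first by rewrite /= size_poly1.
rewrite /q_ size_polyDl size_meixner // ltnS.
by rewrite (leq_trans (size_scale_leq _ _)) // size_meixner.
Qed.

Lemma divp_XsubC (R : fieldType) (x : R) (p : {poly R}) :
  exists2 r : {poly R}, p = p.[x]%:P + ('X - x%:P) * r & size r = (size p).-1.
Proof.
exists (p %/ ('X - x%:P)); last first.
  by rewrite size_divp ?polyXsubC_eq0 // size_XsubC subn1.
by rewrite addrC mulrC -modp_XsubC -divp_eq.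
Qed.

(** Splitting [p] as a constant plus a multiple of the missing factor
   [X + (c - k - 1)] turns [rho_tilde] into the Meixner functional of
   parameter [c]; the constant is annihilated by the choice of [beta_]. *)
Lemma rho_tilde_q (R : realType) (k : nat) (a c : R) (rho : {scalar {poly R}})
    (n : nat) (p : {poly R}) :
  a != 0 -> a != 1 -> pearson a (c - k%:R - 1) rho ->
  gamma_ k a c n.+1 != 0 -> (size p <= n.+2)%N ->
  exists2 r : {poly R}, size r = (size p).-1 &
    rho_tilde k c rho (q_ k a c n.+1 * p) = beta_ k a c n.+1 *
    mul_functional (rising (c - k%:R - 1) k.+1) rho (meixner a c n * r).
Proof.
move=> a0 a1 rho_p g0 sp.
have [r Ep sr] := divp_XsubC (- (c - k%:R - 1)) p; exists r => //.
pose sigma : {scalar {poly R}} :=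
  mul_functional (rising (c - k%:R - 1) k.+1) rho.
rewrite -[mul_functional _ _ _]/(sigma _).
have sigma_p : pearson a c sigma by exact: pearson_rising_shift.
have tildeM s : rho_tilde k c rho (('X - (- (c - k%:R - 1))%:P) * s) = sigma s.
  rewrite rho_tildeE /sigma /= /mul_functional rising_recl subrK polyCN opprK.
  by rewrite mulrA [_ * rising _ _]mulrC.
have q0 : rho_tilde k c rho (q_ k a c n.+1) = 0.
  rewrite /q_ linearD [X in _ + X]scalarZ !rho_tilde_meixner // /beta_.
  by field; rewrite g0 expf_neq0 // subr_eq0.
rewrite {1}Ep mulrDr linearD [_ * _%:P]mulrC mul_polyC scalarZ q0 mulr0 add0r.
rewrite mulrCA tildeM /q_ mulrDl linearD.
rewrite [X in X + _]pearson_orthogonal //; last first.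
  by rewrite sr -subn1 leq_subLR.
by rewrite add0r -scalerAl scalarZ.
Qed.

Lemma q_orthogonal (R : realType) (k : nat) (a c : R)
    (rho : {scalar {poly R}}) :
  a != 0 -> a != 1 -> (forall j : nat, c != k.+1%:R - j%:R) ->
  (forall n, gamma_ k a c n.+1 != 0) ->
  is_meixner_functional a (c - k%:R - 1) rho ->
  orthogonal_polys (rho_tilde k c rho) (q_ k a c).
Proof.
move=> a0 a1 hc g0 [[_ rho0 rho_nz] _].
have rho_p : pearson a (c - k%:R - 1) rho.
  apply: pearson_of_orthogonal => // n.
  by have := rho0 n.+1 0 isT; rewrite expr0 mulr1.
have rho1 : rho 1 != 0 by have := rho_nz 0; rewrite meixner0 mulr1.
have d0 j : c - k%:R - 1 + j%:R != 0.
  apply: contra (hc j) => /eqP E; apply/eqP/subr0_eq; rewrite -E -natr1; ring.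
have a1' : a - 1 != 0 by rewrite subr_eq0.
have c0 (j : nat) : c + j%:R != 0.
  have := d0 (k.+1 + j)%N; rewrite natrD addrA.
  by have -> : c - k%:R - 1 + k.+1%:R = c by rewrite -natr1; ring.
split=> [n|[|n] m //|[|n]].
- exact: size_q.
- rewrite ltnS => mn.
  have sm : (size ('X^m : {poly R}) <= n.+2)%N by rewrite size_polyXn ltnS leqW.
  have [r sr ->] := rho_tilde_q a0 a1 rho_p (g0 n) sm.
  rewrite pearson_orthogonal ?mulr0 //; last by rewrite sr size_polyXn.
  exact: pearson_rising_shift.
- rewrite /q_ expr0 mulr1 -(meixner0 a c) rho_tilde_meixner //.
  rewrite mulf_neq0 // mulf_neq0 //.
  by rewrite mulf_neq0 ?invr_eq0 ?expf_neq0 // pnatr_eq0 -lt0n fact_gt0.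
- have sn : (size ('X^(n.+1) : {poly R}) <= n.+2)%N by rewrite size_polyXn.
  have [r sr ->] := rho_tilde_q a0 a1 rho_p (g0 n) sn.
  rewrite size_polyXn /= in sr.
  rewrite mulf_neq0 //.
    by rewrite /beta_ oppr_eq0 mulf_neq0 // invr_eq0.
  apply: (pearson_norm (c := c)) => //.
    rewrite /= /mul_functional mulr1 (rising_mass _ a1 rho_p) mulf_neq0 //.
    rewrite mulf_neq0 //; first by apply/prodf_neq0 => i _.
    by rewrite invr_eq0 expf_neq0 // subr_eq0 eq_sym.
  exact: pearson_rising_shift.
Qed.

(** * The eigenvalue equation *)

Lemma iter_is_linear (R : realType) (T : {linear {poly R} -> {poly R}})
    (j : nat) : linear (iter j T).
Proof.
by elim: j => [|j IH] u p q //=; rewrite IH linearP.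
Qed.

Lemma op_poly_is_linear (R : realType) (P : {poly R})
    (T : {linear {poly R} -> {poly R}}) : linear (op_poly P T).
Proof.
move=> u p q; rewrite /op_poly scaler_sumr -big_split; apply: eq_bigr => j _ /=.
by rewrite iter_is_linear scalerDr !scalerA mulrC.
Qed.

Lemma op_poly_eigen (R : realType) (P : {poly R})
    (T : {linear {poly R} -> {poly R}}) (l : R) (f : {poly R}) :
  T f = l *: f -> op_poly P T f = P.[l] *: f.
Proof.
move=> Tf; rewrite /op_poly horner_coef scaler_suml; apply: eq_bigr => j _.
rewrite -scalerA; congr (_ *: _).
elim: (nat_of_ord j) => [|i IH]; first by rewrite scale1r.
by rewrite /= IH linearZ /= Tf scalerA exprSr.
Qed.

Lemma D_op_is_linear (R : realType) (k : nat) (a c : R) : linear (D_op k a c).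
Proof.
move=> u p q; rewrite /D_op !op_poly_is_linear linearP /=.
by rewrite !scalerDr !scalerA [a / _ * u]mulrC addrACA.
Qed.

Lemma D_op_meixner (R : realType) (k : nat) (a c : R) (n : nat) :
  a != 0 -> a != 1 ->
  D_op k a c (meixner a c n) = lambda_ k a c n *: meixner a c n
    + (a / (1 - a) * gamma_ k a c n.+1) *: Delta (meixner a c n).
Proof.
move=> a0 a1; have a1' : a - 1 != 0 by rewrite subr_eq0.
have em := meixner_op_meixner c n a0.
rewrite /D_op (op_poly_eigen (T := meixner_op a c) _ em).
rewrite (op_poly_eigen (T := meixner_op a c) _ em).
have -> : (P1 k a c).[n%:R * (a - 1)] = lambda_ k a c n.
  rewrite /P1 /lambda_ hornerZ horner_comp; congr (_ * horner _ _).
  by rewrite hornerN hornerZ hornerX; field.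
have -> : (P2 k a c).[n%:R * (a - 1)] = gamma_ k a c n.+1.
  rewrite /P2 /gamma_ horner_comp; congr horner.
  by rewrite hornerD !hornerN hornerZ hornerX hornerC -natr1; field.
move: (meixner a c n) => m.
by rewrite [Delta (_ *: _)]linearZ /= scalerA.
Qed.

(** The forward shift of [meixner a^-1 (- c + 1) k.+1] at x = - (n + 1). *)
Lemma lambdaS (R : realType) (k : nat) (a c : R) (n : nat) :
  a != 1 -> lambda_ k a c n.+1 = lambda_ k a c n + gamma_ k a c n.+1.
Proof.
move=> a1; have a1' : a - 1 != 0 by rewrite subr_eq0.
have := horner_Delta (meixner a^-1 (- c + 1) k.+1) (- n.+1%:R).
rewrite Delta_meixner invrK hornerZ.
have -> : - n.+1%:R + 1 = - n%:R :> R by rewrite -natr1; ring.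
have -> : - c + 1 + 1 = - c + 2 by ring.
rewrite -/(gamma_ k a c n.+1) /lambda_.
move: (meixner _ _ _).[- n%:R] (meixner _ _ k.+1).[- n.+1%:R] => x y E.
have -> : x = y + (1 - a) * gamma_ k a c n.+1 by rewrite E; ring.
by field.
Qed.

(** The action of D on the two terms of q_(n+1) leaves - gamma_(n+2) times
   m_n^(c+1) - m_(n-1)^(c+1), which is m_n^c by [meixner_cS]. *)
Lemma D_op_q (R : realType) (k : nat) (a c : R) (n : nat) :
  a != 0 -> a != 1 -> (forall n, gamma_ k a c n.+1 != 0) ->
  D_op k a c (q_ k a c n) = lambda_ k a c n *: q_ k a c n.
Proof.
move=> a0 a1 g0; have a1' : a - 1 != 0 by rewrite subr_eq0.
have a1'' : 1 - a != 0 by rewrite subr_eq0 eq_sym.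
case: n => [|n].
  by rewrite /q_ -(meixner0 a c) D_op_meixner // meixner0 Delta1 scaler0 addr0.
have low m : (a / (1 - a) * m) *: ((1 - a^-1) *: meixner a (c + 1) n)
    = - m *: meixner a (c + 1) n.
  by rewrite scalerA; congr (_ *: _); field; rewrite a0.
rewrite /q_ addrC D_op_is_linear !D_op_meixner // Delta_meixner low.
have Eb : beta_ k a c n.+1 * gamma_ k a c n.+1 = - gamma_ k a c n.+2.
  by rewrite /beta_ mulNr divfK.
(* The subtracted m_n^c replaces m_(n-1)^(c+1), which makes no sense for n = 0. *)
suff : (beta_ k a c n.+1 * (a / (1 - a) * gamma_ k a c n.+1))
      *: Delta (meixner a c n)
    = gamma_ k a c n.+2 *: (meixner a (c + 1) n - meixner a c n).
  move: (meixner a c n) (meixner a c n.+1) (meixner a (c + 1) n) (Delta _).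
  move=> m m1 m' d E; rewrite !scalerDr !scalerA E.
  have -> : lambda_ k a c n.+1 * beta_ k a c n.+1
      = beta_ k a c n.+1 * lambda_ k a c n - gamma_ k a c n.+2.
    by rewrite -Eb lambdaS //; ring.
  by rewrite -!mul_polyC !polyCD !polyCN; ring.
have -> : beta_ k a c n.+1 * (a / (1 - a) * gamma_ k a c n.+1)
   = - (a / (1 - a) * gamma_ k a c n.+2) by rewrite mulrCA Eb mulrN.
case: n {low Eb} => [|n].
  by rewrite !meixner0 Delta1 subrr !scaler0.
rewrite Delta_meixner (meixner_cS a c) opprB addrCA subrr addr0 scalerA.
by congr (_ *: _); field; rewrite a0.
Qed.

(** * The genre *)

(** Difference operators with shifts from -N to N, whose extreme coefficients u
   and v may vanish, so that they are closed under sums. The coefficient of the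
   shift by l has index l + N. *)
Definition banded (R : realType) (N : nat) (T : {poly R} -> {poly R})
    (u v : {poly R}) : Prop :=
  exists f : nat -> {poly R},
    [/\ f 0%N = u, f N.*2 = v, forall i, (N.*2 < i)%N -> f i = 0 &
        forall p, T p = \sum_(i < N.*2.+1) f i * shift_op (i%:Z - N%:Z) p].

Lemma banded_id (R : realType) : banded 0 (@id {poly R}) 1 1.
Proof.
exists (fun i => if i is 0%N then 1 else 0); split=> // [[|i]|p] //.
by rewrite big_ord1 subrr shift_op0 mul1r.
Qed.

Lemma banded_zero (R : realType) : banded 0 (fun=> 0 : {poly R}) 0 0.
Proof.
by exists (fun=> 0); split=> // p; rewrite big_ord1 mul0r.
Qed.

Lemma eq_banded (R : realType) (N : nat) (T T' : {poly R} -> {poly R})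
    (u v : {poly R}) : T =1 T' -> banded N T u v -> banded N T' u v.
Proof. by move=> E [f [? ? ? fT]]; exists f; split=> // p; rewrite -E. Qed.

Lemma banded_comb (R : realType) (N : nat) (T T' : {poly R} -> {poly R})
    (u v u' v' : {poly R}) (x : R) :
  banded N T u v -> banded N T' u' v' ->
  banded N (fun p => T p + x *: T' p) (u + x *: u') (v + x *: v').
Proof.
move=> [f [f0 fN fz fT]] [g [g0 gN gz gT]].
exists (fun i => f i + x *: g i); split; rewrite ?f0 ?g0 ?fN ?gN //.
  by move=> i iN; rewrite fz // gz // scaler0 addr0.
move=> p; rewrite fT gT scaler_sumr -big_split; apply: eq_bigr => i _ /=.
by rewrite mulrDl scalerAl.
Qed.

(** Composition on the left with a three-term operator; both [meixner_op] and
   [Delta] have this form. *)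
Lemma banded_comp (R : realType) (N : nat) (T : {poly R} -> {poly R})
    (u v A B C : {poly R}) : banded N T u v ->
  banded N.+1
    (fun p => A * shift_op (-1) (T p) + B * T p + C * shift_op 1 (T p))
    (A * shift_op (-1) u) (C * shift_op 1 v).
Proof.
move=> [f [f0 fN fz fT]].
pose f1 i := if i is j.+1 then f j else 0.
pose f2 i := if i is j.+2 then f j else 0.
exists (fun i => A * shift_op (-1) (f i) + B * f1 i + C * shift_op 1 (f2 i)).
split.
- by rewrite /= f0 linear0 !mulr0 !addr0.
- by rewrite /= fN !fz ?linear0 ?mulr0 ?add0r.
- move=> [|[|i]] //; rewrite doubleS !ltnS => iN.
  have iN1 := leqW iN; have iN2 := leqW iN1.
  by rewrite /= !fz // !linear0 !mulr0 !addr0.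
move=> p; rewrite doubleS.
under eq_bigr do rewrite !mulrDl.
rewrite !big_split /= fT !linear_sum !mulr_sumr; congr (_ + _ + _).
- rewrite [RHS]big_ord_recr [X in _ = X + _]big_ord_recr /=.
  rewrite !fz // ?linear0 ?mulr0 ?mul0r ?addr0.
  apply: eq_bigr => i _; rewrite shift_opM shift_op_comp mulrA.
  by congr (_ * shift_op _ _); rewrite -[N.+1]addn1 PoszD; ring.
- rewrite [RHS]big_ord_recr [X in _ = X + _]big_ord_recl /=.
  rewrite !fz // ?mulr0 ?mul0r ?addr0 ?add0r.
  apply: eq_bigr => i _; rewrite mulrA /=.
  by congr (_ * shift_op _ _); rewrite /bump /= -[N.+1]add1n !PoszD; ring.
- rewrite [RHS]big_ord_recl [X in _ = _ + X]big_ord_recl /=.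
  rewrite !linear0 !mulr0 !mul0r !add0r.
  apply: eq_bigr => i _; rewrite shift_opM shift_op_comp mulrA /=.
  by congr (_ * shift_op _ _); rewrite /bump /= -[N.+1]add1n !PoszD; ring.
Qed.

Lemma banded_iter (R : realType) (a c : R) (j : nat) : a != 0 ->
  exists u v : {poly R}, [/\ size u = j.+1, size v = j.+1 &
    banded j (iter j (meixner_op a c)) u v].
Proof.
move=> a0; elim: j => [|j [u [v [su sv hb]]]].
  by exists 1, 1; rewrite size_poly1; split=> //; exact: banded_id.
exists ('X * shift_op (-1) u), ((a *: ('X + c%:P)) * shift_op 1 v); split.
- rewrite mulrC size_mulX ?size_shift_op ?su //.
  by rewrite -size_poly_eq0 size_shift_op su.
- rewrite -scalerAl size_scale // mulrC size_Mmonic ?monicXaddC //.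
    by rewrite size_shift_op sv size_XaddC addn2.
  by rewrite -size_poly_eq0 size_shift_op sv.
- apply: eq_banded (banded_comp _ (- ((1 + a) *: 'X + (a * c)%:P)) _ hb) => p.
  by rewrite iterS /meixner_op shift_op0 mulNr.
Qed.

Lemma banded_widen (R : realType) (N : nat) (T : {poly R} -> {poly R})
    (u v : {poly R}) : banded N T u v -> banded N.+1 T 0 0.
Proof.
move=> hb; have := banded_comp 0 1 0 hb; rewrite !mul0r; apply: eq_banded => p.
by rewrite !mul0r add0r addr0 mul1r.
Qed.

(** Only the highest power of [meixner_op] reaches the extreme shifts. *)
Lemma banded_op_poly (R : realType) (a c : R) (P : {poly R}) (N : nat) :
  a != 0 -> size P = N.+1 ->
  exists u v : {poly R}, [/\ size u = N.+1, size v = N.+1 &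
    banded N (op_poly P (meixner_op a c)) u v].
Proof.
move=> a0 sP.
have low n : banded n
    (fun f => \sum_(j < n) P`_j *: iter j (meixner_op a c) f) 0 0.
  elim: n => [|n IH].
    by apply: eq_banded (banded_zero R) => p; rewrite big_ord0.
  have [u [v [_ _ hb]]] := banded_iter c n a0.
  apply: eq_banded (banded_widen (banded_comb P`_n IH hb)) => p.
  by rewrite big_ord_recr.
have [u [v [su sv hb]]] := banded_iter c N a0.
have PN : P`_N != 0.
  have : P != 0 by rewrite -size_poly_eq0 sP.
  by rewrite -lead_coef_eq0 lead_coefE sP.
exists (P`_N *: u), (P`_N *: v); split; rewrite ?size_scale //.
have := banded_comb P`_N (low N) hb; rewrite !add0r; apply: eq_banded => p.
by rewrite /op_poly sP big_ord_recr.
Qed.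

Lemma size_affine_comp (R : realType) (p : {poly R}) (x y : R) : x != 0 ->
  size (p \Po (- (x *: 'X) - y%:P)) = size p.
Proof.
move=> x0; have sX : size (- (x *: 'X)) = 2%N.
  by rewrite size_polyN size_scale // size_polyX.
rewrite size_comp_poly2 // size_polyDl sX // size_polyN.
by rewrite (leq_ltn_trans (size_polyC_leq1 _)).
Qed.

(** The extreme coefficients of P1(D_ac) have degree k + 1; the correction
   Delta P2(D_ac) does not reach the lowest shift and reaches the highest one in
   degree k only. *)
Lemma D_op_banded (R : realType) (k : nat) (a c : R) : a != 0 -> a != 1 ->
  exists u v : {poly R}, [/\ u != 0, v != 0 & banded k.+1 (D_op k a c) u v].
Proof.
move=> a0 a1; have b0 : a^-1 != 0 by rewrite invr_eq0.
have b1 : a^-1 != 1 by rewrite invr_eq1.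
have x0 : (a - 1)^-1 != 0 by rewrite invr_eq0 subr_eq0.
have sP1 : size (P1 k a c) = k.+2.
  rewrite /P1 size_scale // -[- _]subr0 -polyC0 size_affine_comp //.
  exact: size_meixner.
have sP2 : size (P2 k a c) = k.+1.
  by rewrite /P2 -polyC1 size_affine_comp // size_meixner.
have [u [v [su sv h1]]] := banded_op_poly c a0 sP1.
have [u2 [v2 [su2 sv2 h2]]] := banded_op_poly c a0 sP2.
have h3 := banded_comb (a / (1 - a)) h1 (banded_comp 0 (-1) 1 h2).
exists u, (v + a / (1 - a) *: shift_op 1 v2); split.
- by rewrite -size_poly_eq0 su.
- rewrite -size_poly_eq0 size_polyDl sv // ltnS.
  by rewrite (leq_trans (size_scale_leq _ _)) // size_shift_op sv2.
- move: h3; rewrite mul0r scaler0 addr0 mul1r; apply: eq_banded => p.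
  by rewrite /D_op /Delta mul0r add0r mulN1r mul1r [- _ + _]addrC.
Qed.

Lemma banded_genre (R : realType) (N : nat) (T : {poly R} -> {poly R})
    (u v : {poly R}) : u != 0 -> v != 0 -> banded N T u v ->
  has_genre T (- N%:Z) N%:Z.
Proof.
move=> u0 v0 [f [f0 fN _ fT]]; split; first by rewrite -subr_ge0 opprK.
have absE : absz (N%:Z - - N%:Z) = N.*2 by rewrite opprK -PoszD addnn.
exists (fun l : int => f (absz (l + N%:Z)%R)); split.
- by rewrite addNr f0.
- by rewrite -PoszD addnn fN.
move=> p; rewrite fT absE; apply: eq_bigr => i _.
by rewrite addrAC addNr add0r [_ + i%:Z]addrC.
Qed.

Theorem theorem5p4 (R : realType) (k : nat) (a c : R)
    (hk : (1 <= k)%N) (ha0 : a != 0) (ha1 : a != 1)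
    (hc : forall j : nat, c != k.+1%:R - j%:R)
    (hm : forall n : nat, (1 <= n)%N ->
            (meixner a^-1 (- c + 2) k).[- n%:R] != 0) :
  (forall rho : {scalar {poly R}},
     is_meixner_functional a (c - k%:R - 1) rho ->
     orthogonal_polys (rho_tilde k c rho) (q_ k a c)) /\
  [/\ has_order (D_op k a c) (2 * k + 2)%N,
      has_genre (D_op k a c) (- (k%:Z) - 1) (k%:Z + 1) &
      forall n : nat, D_op k a c (q_ k a c n) = lambda_ k a c n *: q_ k a c n].
Proof.
have g0 n : gamma_ k a c n.+1 != 0 by exact: hm.
have genre : has_genre (D_op k a c) (- (k%:Z) - 1) (k%:Z + 1).
  have [u [v [u0 v0 hb]]] := D_op_banded k c ha0 ha1.
  have := banded_genre u0 v0 hb.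
  by rewrite -[k.+1]addn1 PoszD opprD.
split=> [rho|]; first exact: q_orthogonal.
split=> [||n] //; last exact: D_op_q.
exists (- (k%:Z) - 1), (k%:Z + 1); split=> //.
by rewrite PoszD PoszM; ring.
Qed.
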